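(* Let $M$ be a nonzero $n\times n$ real symmetric matrix such that for some $S\subseteq[n]$ and $0\le\rho\le1$ we have $\|M_{S\times S}\|\le\rho\|M\|$. Let $v$ be any normalized top eigenvector of $M$. Then $\|v_{S^c}\|^2\ge\frac{(1-\rho)^2}{1+(1-\rho)^2}$.
   Context: $M_{S\times S}$ agrees with $M$ on $S\times S$ and is zero elsewhere; for a vector $v$, $v_{S^c}$ agrees with $v$ on $S^c=[n]\setminus S$ and is zero elsewhere; $\|\cdot\|$ denotes the spectral norm for matrices and Euclidean norm for vectors. A normalized top eigenvector of $M$ is a unit vector $v$ with $Mv=\lambda v$ and $|\lambda|=\|M\|$. *)

(* Defs.v *)
From mathcomp Require Import all_boot all_order all_algebra.
From mathcomp Require Import boolp classical_sets reals.

Set Implicit Arguments.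
Unset Strict Implicit.
Unset Printing Implicit Defensive.

Import Order.TTheory GRing.Theory Num.Theory.

Local Open Scope classical_set_scope.
Local Open Scope ring_scope.

Definition vnorm (R : realType) (n : nat) (v : 'cV[R]_n) : R :=
  Num.sqrt (\sum_i v i 0 ^+ 2).

(* The spectral norm is the operator norm induced by the Euclidean norm; the
   supremum is over a nonempty bounded set, so [sup] is not a default value.
   (The norm `|M| of MathComp-Analysis on matrices is the max norm.) *)
Definition spectral_norm (R : realType) (n : nat) (M : 'M[R]_n) : R :=
  sup [set vnorm (M *m x) | x in [set x : 'cV[R]_n | vnorm x <= 1]].

Definition mx_restr (R : realType) (n : nat) (S : {set 'I_n}) (M : 'M[R]_n) :
    'M[R]_n :=
  \matrix_(i, j) (if (i \in S) && (j \in S) then M i j else 0).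

Definition vec_restr (R : realType) (n : nat) (T : {set 'I_n}) (v : 'cV[R]_n) :
    'cV[R]_n :=
  \col_i (if i \in T then v i 0 else 0).

Definition normalized_top_eigenvector (R : realType) (n : nat) (M : 'M[R]_n)
    (v : 'cV[R]_n) : Prop :=
  vnorm v = 1 /\
  exists lambda : R, M *m v = lambda *: v /\ `|lambda| = spectral_norm M.

(* Main.v *)
Require Import Defs.
From mathcomp Require Import all_boot all_order all_algebra.
From mathcomp Require Import reals.
From mathcomp Require Import classical_sets ring lra.

Set Implicit Arguments.
Unset Strict Implicit.
Unset Printing Implicit Defensive.

Import Order.TTheory GRing.Theory Num.Theory.

Local Open Scope ring_scope.

(** Split [v = a + b] with [a] supported on [S] and [b] on its complement.
    Reading [M v = lambda v] on the coordinates in [S] gives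
    [lambda a = M_{SxS} a + (M b)_S], hence
    [|lambda| |a| <= rho |lambda| |a| + |lambda| |b|], that is
    [(1 - rho) |a| <= |b|]; conclude with [|a|^2 + |b|^2 = 1]. *)

Section EuclideanNorm.
Variables (R : realType) (n : nat).
Implicit Types (x y : 'cV[R]_n) (T : {set 'I_n}).

Lemma vnorm_ge0 x : 0 <= vnorm x.
Proof. exact: sqrtr_ge0. Qed.

Lemma sqr_vnorm x : vnorm x ^+ 2 = \sum_i x i 0 ^+ 2.
Proof. by rewrite sqr_sqrtr// sumr_ge0// => i _; apply: sqr_ge0. Qed.

Lemma vnorm0 : vnorm (0 : 'cV[R]_n) = 0.
Proof.
apply/eqP; rewrite -sqrf_eq0 sqr_vnorm big1// => i _.
by rewrite mxE expr0n.
Qed.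

Lemma vnorm_eq0 x : vnorm x = 0 -> x = 0.
Proof.
move=> x0; have := sqr_vnorm x; rewrite x0 expr0n /= => /esym/psumr_eq0P H.
apply/colP => i; rewrite mxE; apply/eqP; rewrite -sqrf_eq0; apply/eqP.
by apply: H => // j _; apply: sqr_ge0.
Qed.

Lemma vnormZ (c : R) x : vnorm (c *: x) = `|c| * vnorm x.
Proof.
apply/eqP; rewrite -(eqrXn2 (n := 2))// ?mulr_ge0 ?vnorm_ge0//.
rewrite exprMn !sqr_vnorm real_normK ?num_real// mulr_sumr.
by apply/eqP/eq_bigr => i _; rewrite mxE exprMn.
Qed.

Lemma ler_norm_coord_vnorm x i : `|x i 0| <= vnorm x.
Proof.
rewrite -(ler_pXn2r (n := 2))// ?nnegrE ?vnorm_ge0//.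
rewrite real_normK ?num_real// sqr_vnorm (bigD1 i)//= lerDl.
by rewrite sumr_ge0// => j _; apply: sqr_ge0.
Qed.

(** For [y] nonzero, the residual of projecting [x] onto [y], scaled by [vnorm y ^+ 2] to avoid
    division, has nonnegative squared length; expanding that length gives the inequality between
    squares. *)
Lemma cauchy_schwarz_vnorm x y :
  \sum_i x i 0 * y i 0 <= vnorm x * vnorm y.
Proof.
move CE : (\sum_i _) => C.
have [/vnorm_eq0 y0|yn0] := eqVneq (vnorm y) 0.
  by rewrite -CE y0 vnorm0 mulr0 big1// => i _; rewrite mxE mulr0.
have yp : 0 < vnorm y by rewrite lt_def yn0 vnorm_ge0.
have : 0 <= \sum_i (vnorm y ^+ 2 * x i 0 - C * y i 0) ^+ 2.
  by apply: sumr_ge0 => i _; apply: sqr_ge0.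
have -> : \sum_i (vnorm y ^+ 2 * x i 0 - C * y i 0) ^+ 2 =
    vnorm y ^+ 2 * ((vnorm x * vnorm y) ^+ 2 - C ^+ 2).
  transitivity (vnorm y ^+ 4 * (\sum_i x i 0 ^+ 2)
     - (2 * vnorm y ^+ 2 * C) * (\sum_i x i 0 * y i 0) + C ^+ 2 * \sum_i y i 0 ^+ 2).
    rewrite !mulr_sumr -sumrB -big_split/=.
    by apply: eq_bigr => i _; ring.
  by rewrite -!sqr_vnorm CE; ring.
rewrite pmulr_rge0 ?exprn_gt0// subr_ge0 => CS.
(* [C] may be negative, so it is replaced by its absolute value before squares are compared. *)
apply: le_trans (ler_norm _) _.
rewrite -(ler_pXn2r (n := 2))// ?nnegrE ?mulr_ge0 ?vnorm_ge0//.
by rewrite real_normK ?num_real.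
Qed.

Lemma ler_vnormD x y : vnorm (x + y) <= vnorm x + vnorm y.
Proof.
rewrite -(ler_pXn2r (n := 2))// ?nnegrE ?addr_ge0 ?vnorm_ge0//.
have -> : vnorm (x + y) ^+ 2 =
    vnorm x ^+ 2 + 2 * (\sum_i x i 0 * y i 0) + vnorm y ^+ 2.
  rewrite !sqr_vnorm mulr_sumr -!big_split/=.
  by apply: eq_bigr => i _; rewrite mxE; ring.
have := cauchy_schwarz_vnorm x y; nra.
Qed.

Lemma vec_restrD T x y : vec_restr T (x + y) = vec_restr T x + vec_restr T y.
Proof. by apply/colP => i; rewrite !mxE; case: ifP; rewrite ?addr0. Qed.

Lemma vec_restrZ T (c : R) x : vec_restr T (c *: x) = c *: vec_restr T x.
Proof. by apply/colP => i; rewrite !mxE; case: ifP; rewrite ?mulr0. Qed.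

Lemma vec_restr_setC T x : vec_restr T x + vec_restr (~: T) x = x.
Proof.
by apply/colP => i; rewrite !mxE finset.in_setC; case: ifP; rewrite ?addr0 ?add0r.
Qed.

Lemma sqr_vnorm_restr_setC T x :
  vnorm (vec_restr T x) ^+ 2 + vnorm (vec_restr (~: T) x) ^+ 2 = vnorm x ^+ 2.
Proof.
rewrite !sqr_vnorm -big_split/=; apply: eq_bigr => i _; rewrite !mxE finset.in_setC.
by case: ifP; rewrite expr0n ?addr0 ?add0r.
Qed.

Lemma ler_vnorm_restr T x : vnorm (vec_restr T x) <= vnorm x.
Proof.
rewrite -(ler_pXn2r (n := 2))// ?nnegrE ?vnorm_ge0//.
by rewrite -(sqr_vnorm_restr_setC T x) lerDl sqr_ge0.
Qed.

Lemma ler_vnorm x y :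
  (forall i, `|x i 0| <= y i 0) -> vnorm x <= vnorm y.
Proof.
move=> xy; rewrite -(ler_pXn2r (n := 2))// ?nnegrE ?vnorm_ge0// !sqr_vnorm.
apply: ler_sum => i _; rewrite -[leLHS]real_normK ?num_real//.
by rewrite ler_pXn2r// ?nnegrE// (le_trans _ (xy i)).
Qed.

End EuclideanNorm.

Section SpectralNorm.
Variables (R : realType) (n : nat).
Implicit Types (M : 'M[R]_n) (x : 'cV[R]_n) (S : {set 'I_n}).

(** Coordinates of a vector in the unit ball are at most 1 in absolute value, so the vector of
    absolute row sums of [M] dominates [M *m x] entrywise. Boundedness ensures that the [sup] in
    [spectral_norm] is a genuine supremum. *)
Lemma vnorm_mulmx_has_ubound M :
  has_ubound
    [set vnorm (M *m x) | x in [set x : 'cV[R]_n | vnorm x <= 1]]%classic.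
Proof.
exists (vnorm (\col_i \sum_j `|M i j|)) => _ [x /= x1 <-].
apply: ler_vnorm => i; rewrite !mxE.
apply: le_trans (ler_norm_sum _ _ _) _; apply: ler_sum => j _.
rewrite normrM ler_piMr//.
exact: le_trans (ler_norm_coord_vnorm _ _) x1.
Qed.

(** For nonzero [x], rescaling to a unit vector gives a member of the set whose supremum is
    [spectral_norm M]. *)
Lemma ler_vnorm_mulmx M x : vnorm (M *m x) <= spectral_norm M * vnorm x.
Proof.
have [/vnorm_eq0 ->|xn0] := eqVneq (vnorm x) 0.
  by rewrite mulmx0 vnorm0 mulr0.
have xp : 0 < vnorm x by rewrite lt_def xn0 vnorm_ge0.
rewrite -ler_pdivrMr// mulrC -[(vnorm x)^-1]ger0_norm ?invr_ge0 ?vnorm_ge0//.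
rewrite -vnormZ scalemxAr; apply: (ub_le_sup (vnorm_mulmx_has_ubound M)).
exists ((vnorm x)^-1 *: x) => //=.
by rewrite vnormZ ger0_norm ?invr_ge0 ?vnorm_ge0// mulVf.
Qed.

(** Applying [ler_vnorm_mulmx] to the basis vectors [delta_mx j 0] forces every column of [M] to
    vanish. *)
Lemma spectral_norm_eq0 M : spectral_norm M = 0 -> M = 0.
Proof.
move=> M0; apply/matrixP => i j; rewrite mxE.
have /vnorm_eq0/colP/(_ i) : vnorm (M *m (delta_mx j 0 : 'cV_n)) = 0.
  apply/eqP; rewrite eq_le vnorm_ge0 andbT.
  by have := ler_vnorm_mulmx M (delta_mx j 0); rewrite M0 mul0r.
by rewrite -colE !mxE.
Qed.

Lemma vec_restr_mulmx_restr S M x :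
  vec_restr S (M *m vec_restr S x) = mx_restr S M *m vec_restr S x.
Proof.
apply/colP => i; rewrite !mxE; case: ifP => iS.
  by apply: eq_bigr => j _; rewrite !mxE iS /=; case: ifP; rewrite ?mulr0.
by rewrite big1// => j _; rewrite !mxE iS mul0r.
Qed.

Lemma eigenvector_restr_bound S M x (lambda : R) :
  M *m x = lambda *: x ->
  `|lambda| * vnorm (vec_restr S x) <=
    spectral_norm (mx_restr S M) * vnorm (vec_restr S x) +
    spectral_norm M * vnorm (vec_restr (~: S) x).
Proof.
(* Only the [x] multiplied by [M] is split into its two restrictions; the other occurrences stay
   intact. *)
move=> Mx; rewrite -vnormZ -vec_restrZ -Mx -{1}(vec_restr_setC S x) mulmxDr.
rewrite vec_restrD vec_restr_mulmx_restr.
apply: le_trans (ler_vnormD _ _) _; apply: lerD; first exact: ler_vnorm_mulmx.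
exact: le_trans (ler_vnorm_restr _ _) (ler_vnorm_mulmx _ _).
Qed.

End SpectralNorm.

Theorem theorem4p11 (R : realType) (n : nat) (M : 'M[R]_n) (S : {set 'I_n})
    (rho : R) (v : 'cV[R]_n)
    (M_neq0 : M <> 0)
    (M_sym : M^T = M)
    (rho_ge0 : 0 <= rho) (rho_le1 : rho <= 1)
    (M_S : spectral_norm (mx_restr S M) <= rho * spectral_norm M)
    (v_top : normalized_top_eigenvector M v) :
  (1 - rho) ^+ 2 / (1 + (1 - rho) ^+ 2) <= vnorm (vec_restr (~: S) v) ^+ 2.
Proof.
have [v1 [lambda [Mv normM]]] := v_top.
(* Nonnegativity comes from [normM], which writes the norm as an absolute value; nonvanishing comes
   from [M_neq0]. *)
have M_gt0 : 0 < spectral_norm M.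
  rewrite lt_def -{2}normM normr_ge0 andbT.
  by apply/eqP => /spectral_norm_eq0.
have := eigenvector_restr_bound S Mv.
have := sqr_vnorm_restr_setC S v; rewrite v1 normM.
have := vnorm_ge0 (vec_restr S v).
have := vnorm_ge0 (vec_restr (~: S) v).
set a := vnorm (vec_restr S v); set b := vnorm (vec_restr (~: S) v).
move=> b0 a0 ab1 bound.
(* After multiplication by [spectral_norm M], this is [bound] combined with [M_S] times [a]. *)
have ab : (1 - rho) * a <= b.
  rewrite -(ler_pM2l M_gt0).
  have := ler_wpM2r a0 M_S; lra.
(* Squaring preserves the order because [rho_le1] makes the left side nonnegative. *)
have : ((1 - rho) * a) ^+ 2 <= b ^+ 2.
  by rewrite ler_pXn2r// nnegrE// mulr_ge0// subr_ge0.
(* With the denominator cleared and [a ^+ 2] replaced by [1 - b ^+ 2], the squared inequality is a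
   rearrangement of the goal. *)
rewrite ler_pdivrMr; last by rewrite ltr_wpDr ?sqr_ge0.
rewrite exprMn.
have -> : a ^+ 2 = 1 - b ^+ 2 by lra.
lra.
Qed.
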